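(* Let $\mathrm{sdf}(n)$ denote the size of the largest square-difference-free subset of $\{1,\ldots,n\}$. Then $$\mathrm{sdf}(n) \ge \Omega\bigl(n^{\frac12(1+\log_{205} 12)}\bigr),$$ where $\tfrac12(1+\log_{205}12)=0.7334\cdots$; that is, there exist a constant $C>0$ and an $n_0$ such that $\mathrm{sdf}(n)\ge C\, n^{\frac12(1+\log_{205} 12)}$ for all $n\ge n_0$.
   Context: $\mathbb{N}=\{1,2,3,\ldots\}$. A set $A\subseteq \mathbb{N}$ is square-difference free if there do not exist $x,y\in A$, $x\neq y$, such that $|x-y|$ is a perfect square (the square of an integer). For $n\in\mathbb{N}$, $\mathrm{sdf}(n)$ is the maximum cardinality of a square-difference-free subset of $\{1,\ldots,n\}$. *)

(* Defs.v *)
From HB Require Import structures.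
From mathcomp Require Import all_boot all_order all_algebra finmap.
From mathcomp Require Import boolp classical_sets reals exp.

Set Implicit Arguments.
Unset Strict Implicit.
Unset Printing Implicit Defensive.

Import Order.TTheory GRing.Theory Num.Theory.
Local Open Scope ring_scope.

(* The difference is taken in int, since subtraction on nat is truncated. *)
Definition is_square_difference (x y : nat) : Prop :=
  exists k : int, `|x%:Z - y%:Z| = k ^+ 2.

Definition square_difference_free (A : set nat) : Prop :=
  ~ exists x y : nat, [/\ A x, A y, x <> y & is_square_difference x y].

Definition interval_1n (n : nat) : {fset nat} := [fset i in iota 1 n]%fset.

Definition sdf (n : nat) : nat :=
  \max_(A <- fpowerset (interval_1n n) | `[< square_difference_free [set` A] >])
    #|` A|%fset.

Definition logb (R : realType) (b x : R) : R := ln x / ln b.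

(* Main.v *)
(** Ruzsa's construction. Let [m] be squarefree and let [S] be a set of residues
    modulo [m] no two of which differ by a square modulo [m]. Write integers in
    base [m], with digits from [S] in the even positions and arbitrary digits in
    the odd positions. If two such integers differ by [q ^ 2], their lowest digits
    agree by the choice of [S], so [m] divides [q]; hence [m ^ 2] divides the
    difference, the next digits agree as well, and dividing by [m ^ 2] gives a
    descent. This yields [(|S| m) ^ k] integers below [m ^ (2 k)]. The exponent of
    the theorem comes from [m = 205 = 5 * 41] and a set [S] of 12 residues. *)

Require Import Defs.
From mathcomp Require Import all_boot all_order all_algebra finmap.
From mathcomp Require Import boolp classical_sets reals exp.
From mathcomp Require Import zify ring lra.

Import Order.TTheory GRing.Theory Num.Theory.

Local Open Scope nat_scope.

(** Adding the square on one side avoids truncated subtraction; since [a] and [b] range over all of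
    [S], both signs of the difference are covered. *)
Definition sdf_mod (m : nat) (S : seq nat) : Prop :=
  {in S &, forall a b q, a = b + q ^ 2 %[mod m] -> a = b}.

(** A restricted and a free digit in base [m] merge into one digit in base [m ^ 2], so that each
    descent step removes exactly one such digit. *)
Definition digit_pairs (m : nat) (S : seq nat) : seq nat :=
  [seq a + m * b | a <- S, b <- iota 0 m].

Fixpoint ruzsa (m : nat) (S : seq nat) (k : nat) : seq nat :=
  if k is k'.+1 then
    [seq d + m ^ 2 * t | d <- digit_pairs m S, t <- ruzsa m S k']
  else [:: 0].

Lemma eq_add_mul (m a b s t : nat) :
  a < m -> b < m -> a + m * s = b + m * t -> a = b /\ s = t.
Proof.
move=> am bm E; have ab : a = b.
  have := congr1 (modn^~ m) E.
  by rewrite ![_ + m * _]addnC ![m * _]mulnC !modnMDl !modn_small.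
split=> //; move/eqP: E; rewrite ab eqn_add2l eqn_pmul2l; last by lia.
by move/eqP.
Qed.

Lemma digit_pairs_lt (m : nat) (S : seq nat) (d : nat) :
  all (fun a => a < m) S -> d \in digit_pairs m S -> d < m ^ 2.
Proof.
move=> /allP Sm /allpairsP[[a b]] /= [/Sm am]; rewrite mem_iota => bm ->.
by nia.
Qed.

Lemma digit_pairs_uniq (m : nat) (S : seq nat) :
  all (fun a => a < m) S -> uniq S -> uniq (digit_pairs m S).
Proof.
move=> /allP Sm US; apply: allpairs_uniq => //; first exact: iota_uniq.
move=> [a b] [a' b'] /allpairsP[[u v] /= [/Sm ul _ [-> _]]].
move=> /allpairsP[[u' v'] /= [/Sm ul' _ [-> _]]] /= E.
by have [-> ->] := eq_add_mul _ _ _ _ _ ul ul' E.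
Qed.

Lemma ruzsa_uniq (m : nat) (S : seq nat) (k : nat) :
  all (fun a => a < m) S -> uniq S -> uniq (ruzsa m S k).
Proof.
move=> Sm US; elim: k => //= k IHk.
apply: allpairs_uniq => //; first exact: digit_pairs_uniq.
move=> [d t] [d' t'] /allpairsP[[u v] /= [/(digit_pairs_lt _ _ _ Sm) ul _ [-> _]]].
move=> /allpairsP[[u' v'] /= [/(digit_pairs_lt _ _ _ Sm) ul' _ [-> _]]] /= E.
by have [-> ->] := eq_add_mul _ _ _ _ _ ul ul' E.
Qed.

Lemma size_ruzsa (m : nat) (S : seq nat) (k : nat) :
  size (ruzsa m S k) = (size S * m) ^ k.
Proof. by elim: k => //= k IHk; rewrite !size_allpairs size_iota IHk expnS. Qed.

Lemma ruzsa_lt (m : nat) (S : seq nat) (k x : nat) :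
  all (fun a => a < m) S -> x \in ruzsa m S k -> x < (m ^ 2) ^ k.
Proof.
move=> Sm; elim: k x => [|k IHk] x /=; first by rewrite inE => /eqP->.
case/allpairsP=> [[d t]] /= [/(digit_pairs_lt _ _ _ Sm) dm /IHk tk ->].
rewrite [_ ^ k.+1]expnS; apply: (@leq_trans (m ^ 2 * t.+1)); last first.
  by rewrite leq_mul2l tk orbT.
by rewrite mulnS ltn_add2r.
Qed.

Lemma ruzsa_sdf (m : nat) (S : seq nat) (k x y q : nat) :
    (forall p, m %| p ^ 2 -> m %| p) -> sdf_mod m S ->
    x \in ruzsa m S k -> y \in ruzsa m S k -> x = y + q ^ 2 -> x = y.
Proof.
move=> sqfree_m sdfS; elim: k x y q => [|k IHk] x y q /=.
  by rewrite !inE => /eqP-> /eqP->.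
case/allpairsP=> [[d t]] /= [dD tT ->]; case/allpairsP: dD => [[a b]] /= [aS + ->].
rewrite mem_iota /= add0n => bm.
case/allpairsP=> [[d' t']] /= [dD' tT' ->].
case/allpairsP: dD' => [[a' b']] /= [aS' + ->].
rewrite mem_iota /= add0n => bm' E.
have low u v w : u + m * v + m ^ 2 * w = u %[mod m].
  by rewrite -addnA -mulnn -mulnA -mulnDr addnC mulnC modnMDl.
have aa' : a = a'.
  by apply: (sdfS _ _ aS aS' q); rewrite -(low a b t) E -modnDml low modnDml.
rewrite -aa' in E.
have {}E : m * (b + m * t) = m * (b' + m * t') + q ^ 2.
  by rewrite -mulnn in E; lia.
have /dvdnP[c qE] : m %| q.
  by apply: sqfree_m; rewrite -(dvdn_addr _ (dvdn_mulr (b' + m * t') (dvdnn m))) -E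
                              dvdn_mulr.
have m_gt0 : 0 < m by lia.
(* With [q = c * m], cancelling one factor [m] leaves [m * c ^ 2], which joins the higher digits;
   the induction then applies to [t] and [t'] with root [c]. *)
have {}E : b + m * t = b' + m * (t' + c ^ 2).
  by apply/eqP; rewrite -(eqn_pmul2l m_gt0) E qE; apply/eqP; ring.
have [-> tE] := eq_add_mul _ _ _ _ _ bm bm' E.
by rewrite aa' (IHk _ _ _ tT tT' tE).
Qed.

Lemma sdf_ge_ruzsa (m : nat) (S : seq nat) (k n : nat) :
    (forall p, m %| p ^ 2 -> m %| p) -> sdf_mod m S ->
    all (fun a => a < m) S -> uniq S -> (m ^ 2) ^ k <= n ->
  (size S * m) ^ k <= sdf n.
Proof.
(* The construction starts at 0 and the interval at 1; the shift preserves differences. *)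
move=> sqfree_m sdfS Sm US kn; pose T := [seq x.+1 | x <- ruzsa m S k].
rewrite /sdf.
apply: (bigmaxn_sup_seq [fset x in T]%fset).
- rewrite fpowersetE; apply/fsubsetP => x.
  rewrite !inE /= => /mapP[y /(ruzsa_lt _ _ _ _ Sm) ym ->].
  by rewrite mem_iota; lia.
- apply/asboolP => -[x [y]]; rewrite /= !inE => -[/mapP[x' xT ->] /mapP[y' yT ->]].
  move=> ne [q qE].
  have [E|E] : x' = y' + `|q|%N ^ 2 \/ y' = x' + `|q|%N ^ 2.
  + have : `|(x'%:Z - y'%:Z)%R|%N = `|q|%N ^ 2 by rewrite -abszX -qE; lia.
    lia.
  + by apply: ne; congr _.+1; apply: ruzsa_sdf xT yT E.
  + by apply: ne; congr _.+1; apply/esym; apply: ruzsa_sdf yT xT E.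
- rewrite card_fseq undup_id ?size_map ?size_ruzsa //.
  by rewrite map_inj_uniq ?ruzsa_uniq // => ? ? [].
Qed.

(** Rounding [n] down to a power of [m ^ 2] loses at most one factor [(m ^ 2) ^ e = size S * m],
    where [e] is the exponent; this is where the constant comes from. *)
Lemma sdf_ge_powR (R : realType) (m : nat) (S : seq nat) (n : nat) :
    (forall p, m %| p ^ 2 -> m %| p) -> sdf_mod m S ->
    all (fun a => a < m) S -> uniq S -> 1 < m -> 0 < size S -> 0 < n ->
  (((size S * m)%:R^-1 : R) *
    n%:R `^ (1 / 2 * (1 + logb m%:R (size S)%:R)) <= (sdf n)%:R)%R.
Proof.
move=> sqfree_m sdfS Sm US m_gt1 S_gt0 n_gt0.
set s := size S in S_gt0 *; set e : R := (1 / 2 * _)%R.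
have M_gt1 : 1 < m ^ 2 by rewrite -(exp1n 2) ltn_exp2r.
have m0 : (0 < m%:R :> R)%R by rewrite ltr0n ltnW.
have s0 : (0 < s%:R :> R)%R by rewrite ltr0n.
have lnm : (0 < ln (m%:R : R))%R by rewrite ln_gt0 // ltr1n.
have e_ge0 : (0 <= e)%R.
  apply: mulr_ge0; first by lra.
  apply: addr_ge0 => //.
  by apply: divr_ge0 (ltW lnm); rewrite ln_ge0 ?ler1n.
have powR_sqr_e : ((m ^ 2)%:R `^ e = (s * m)%:R :> R)%R.
  rewrite natrX natrM -[LHS]lnK ?posrE ?powR_gt0 ?exprn_gt0 //.
  rewrite -[RHS]lnK ?posrE ?mulr_gt0 // ln_powR lnXn // lnM ?posrE //.
  congr (_ _); rewrite /e /logb; field; exact: lt0r_neq0.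
pose k := trunc_log (m ^ 2) n.
have sdf_ge : (s * m) ^ k <= sdf n by apply: sdf_ge_ruzsa => //; exact: trunc_logP.
rewrite mulrC ler_pdivrMr ?ltr0n ?muln_gt0 ?S_gt0 1?ltnW //.
have n_lt : (n%:R <= ((m ^ 2)%:R : R) ^+ k.+1)%R.
  by rewrite -natrX ler_nat ltnW // trunc_log_ltn.
apply: (le_trans (ge0_ler_powR e_ge0 _ _ n_lt)); rewrite ?nnegrE ?exprn_ge0 //.
rewrite -powR_mulrn // -powRrM mulrC powRrM powR_sqr_e powR_mulrn //.
by rewrite -natrX -natrM ler_nat expnSr leq_mul2r sdf_ge orbT.
Qed.

Definition residues205 : seq nat :=
  [:: 0; 2; 8; 14; 77; 79; 85; 96; 103; 109; 111; 181].

Lemma squarefree205 (q : nat) : 205 %| q ^ 2 -> 205 %| q.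
Proof.
rewrite -[205]/(5 * 41) !Gauss_dvd // => /andP[].
by rewrite !Euclid_dvdX // => /andP[-> _] /andP[-> _].
Qed.

(** A square modulo 205 is a square modulo both 5 and 41, so it suffices that distinct residues
    differ by a non-square modulo one of these primes. This leaves a finite check with [q] reduced
    modulo 5 or 41. *)
Lemma sdf_mod_residues205 : sdf_mod 205 residues205.
Proof.
pose diff_sq p a b := has (fun q => a == b + q ^ 2 %[mod p]) (iota 0 p).
have chk : all (fun a => all (fun b =>
    diff_sq 5 a b ==> diff_sq 41 a b ==> (a == b)) residues205) residues205.
  by vm_compute.
have diff_sqP p a b q : 0 < p -> p %| 205 -> a = b + q ^ 2 %[mod 205] ->
    diff_sq p a b.
  move=> p0 dp E; apply/hasP; exists (q %% p).
    by rewrite mem_iota /= add0n ltn_mod.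
  rewrite -modnDmr modnXm modnDmr.
  by rewrite -(modn_dvdm a dp) E modn_dvdm.
move=> a b aS bS q E; move/allP/(_ _ aS)/allP/(_ _ bS): chk.
by rewrite !(diff_sqP _ _ _ q) //= => /eqP.
Qed.

(** This and the next inequality, after taking logarithms, bracket the logarithm of 12 to base 205
    between 204/437 and 99/212. These fractions lie between 0.4668 and 0.467, the bounds needed for
    the decimals 0.7334 of the exponent. *)
Lemma expn_205_204 : 205 ^ 204 <= 12 ^ 437.
Proof. lia. Qed.

Lemma expn_12_212 : 12 ^ 212 <= 205 ^ 99.
Proof. lia. Qed.

Local Open Scope ring_scope.

Theorem theorem3p7 (R : realType) :
  let e : R := 1 / 2 * (1 + logb 205 12) in
  (exists C : R, 0 < C /\
    exists n0 : nat, forall n : nat, (n0 <= n)%N ->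
      C * n%:R `^ e <= (sdf n)%:R) /\
  7334 / 10000 <= e < 7335 / 10000.
Proof.
move=> e.
have l12 : 0 < ln (12 : R) by rewrite ln_gt0 // ltr1n.
have l205 : 0 < ln (205 : R) by rewrite ln_gt0 // ltr1n.
have e_bnd : 7334 / 10000 <= e < 7335 / 10000.
  have lb : ln (205 : R) *+ 204 <= ln 12 *+ 437.
    by rewrite -!lnXn // ler_ln ?posrE ?exprn_gt0 // -!natrX ler_nat expn_205_204.
  have ub : ln (12 : R) *+ 212 <= ln 205 *+ 99.
    by rewrite -!lnXn // ler_ln ?posrE ?exprn_gt0 // -!natrX ler_nat expn_12_212.
  have : 204 / 437 <= logb 205 12 :> R.
    by rewrite /logb ler_pdivlMr //; lra.
  have : logb 205 12 <= 99 / 212 :> R.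
    by rewrite /logb ler_pdivrMr //; lra.
  by rewrite /e; lra.
split=> //; exists (12 * 205)%:R^-1; split; first by rewrite invr_gt0 ltr0n.
exists 1%N => n n_gt0.
apply: (@sdf_ge_powR R 205 residues205) => //.
- exact: squarefree205.
- exact: sdf_mod_residues205.
Qed.
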